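(* Let $1\le M\le N$ and let $\vec w=(w_1,\dots,w_N)$ be a weight vector with positive entries summing to $1$, sorted in non-decreasing order, $w_1\le\dots\le w_N$. Let $G_1,\dots,G_M$ be the partition of $[N]$ into consecutive blocks used by the algorithm Representative Electoral College. If one sets $$p_m=\sum_{i\in G_m}w_i,\qquad m\in[M],$$ then the sortition algorithm Representative Electoral College with these $p_m$ is fair, i.e. $\mathbb{E}[g(n;\mathcal{M})]=w_n$ for all $n\in[N]$.
   Context: Setting: there are $N$ participants, indexed by $[N]=\{1,\dots,N\}$, with positive weights $w_i$, $\sum_i w_i=1$. A sortition algorithm outputs a random committee $\mathcal{M}\subseteq[N]$ of size $M$ and unnormalized weights $g_n$; the voting power is $g(n;\mathcal{M})=g_n/\sum_{m\in\mathcal{M}}g_m$ for $n\in\mathcal{M}$ and $g(n;\mathcal{M})=0$ for $n\notin\mathcal{M}$. The algorithm is fair (on $\vec w$) if $\mathbb{E}[g(n;\mathcal{M})]=w_n$ for all $n\in[N]$. Algorithm Representative Electoral College (input $\vec w$, $M$): (1) sort participants so that $w_1\le\dots\le w_N$; (2) split $[N]$ into $M$ consecutive groups: $G_1$ consists of the first $N_1$ participants, $G_2$ of the next $N_2$, and so on up to $G_M$, where $N_i=\lfloor N/M\rfloor+\mathbf{1}\big((N\bmod M)\ge i\big)$; (3) compute $p_1,\dots,p_M$; (4) select $\mathcal{M}=\{m_1,\dots,m_M\}$ randomly such that $m_i$ is drawn from $G_i$ with $\mathbb{P}(m_i=j)=\frac{w_j}{\sum_{n\in G_i}w_n}$ for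 each $j\in G_i$; (5) set $g_{m_i}=p_i$ for $i\in[M]$ and $g_m=0$ for $m\notin\mathcal{M}$. *)

(* Defs.v *)
From mathcomp Require Import all_boot all_order all_algebra.
From mathcomp Require Import all_classical all_reals all_analysis.

Set Implicit Arguments.
Unset Strict Implicit.
Unset Printing Implicit Defensive.

Import Order.TTheory GRing.Theory Num.Theory.

Local Open Scope ring_scope.

(* Participants [N] = {1, ..., N} are 'I_N and group indices [M] are 'I_M, so
   every index below is one less than the usual 1-based one. *)

Definition is_weight_vector (R : realType) (N : nat) (w : 'I_N -> R) : Prop :=
  (forall n, 0 < w n) /\ \sum_n w n = 1.

Definition voting_power (R : realType) (N : nat)
    (A : {set 'I_N}) (g : 'I_N -> R) (n : 'I_N) : R :=
  if n \in A then g n / \sum_(k in A) g k else 0.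

(* The output of a sortition algorithm on a weight vector is a random committee
   and random unnormalized weights, as functions on a probability space. *)
Definition fair (R : realType) (d : measure_display) (T : measurableType d)
    (P : probability T R) (N : nat) (w : 'I_N -> R)
    (committee : T -> {set 'I_N}) (g : T -> 'I_N -> R) : Prop :=
  forall n, ('E_P[fun t => voting_power (committee t) (g t) n] = (w n)%:E)%E.

(* The indicator 1((N mod M) >= i), with the 1-based i equal to k.+1. *)
Definition group_size (N M k : nat) : nat := (N %/ M + (k < N %% M))%N.

(* The first participant of the group of 0-based index k. *)
Definition group_start (N M k : nat) : nat :=
  (\sum_(0 <= l < k) group_size N M l)%N.

Definition group (N M : nat) (i : 'I_M) : {set 'I_N} :=
  [set j : 'I_N | (group_start N M i <= j < group_start N M i.+1)%N]%SET.

(* Only the marginal laws of the draws m_1, ..., m_M are prescribed; their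
   joint law is arbitrary, independent draws being one instance. Measurability
   is with respect to the discrete sigma-algebra on the finite type 'I_N. *)
Definition rec_draws (R : realType) (d : measure_display)
    (T : measurableType d) (P : probability T R) (N M : nat) (w : 'I_N -> R)
    (m : 'I_M -> T -> 'I_N) : Prop :=
  [/\ forall i j, measurable (m i @^-1` [set j])%classic,
      forall i t, m i t \in group N i
    & forall i j, j \in group N i ->
        P (m i @^-1` [set j])%classic
        = (w j / \sum_(n in group N i) w n)%:E].

Definition rec_committee (T : Type) (N M : nat)
    (m : 'I_M -> T -> 'I_N) (t : T) : {set 'I_N} :=
  [set m i t | i : 'I_M]%SET.

(* The groups being disjoint, at most one i satisfies m i t = n. *)
Definition rec_weight (R : realType) (T : Type) (N M : nat) (p : 'I_M -> R)
    (m : 'I_M -> T -> 'I_N) (t : T) (n : 'I_N) : R :=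
  if [pick i | m i t == n] is Some i then p i else 0.

(* Main.v *)
(* The groups partition the participants, so the committee contains exactly one
   member of each group and its total unnormalized weight is always
   [\sum_k p k = 1]. Hence the voting power of [n], lying in group [k], is [p k]
   times the indicator of the event [m k = n], of probability [w n / p k]. *)

Require Import Defs.
From mathcomp Require Import all_boot all_order all_algebra.
From mathcomp Require Import all_classical all_reals all_analysis.
From mathcomp Require Import zify.

Import Order.TTheory GRing.Theory Num.Theory.

Local Open Scope ring_scope.

Lemma group_startS (N M k : nat) :
  group_start N M k.+1 = (group_start N M k + group_size N M k)%N.
Proof. by rewrite /group_start big_nat_recr. Qed.

Lemma group_start0 (N M : nat) : group_start N M 0 = 0%N.
Proof. by rewrite /group_start big_geq. Qed.

Lemma leq_group_start (N M : nat) : {homo group_start N M : k l / (k <= l)%N}.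
Proof.
apply: homo_leq => [k|l k n|k]; [exact: leqnn|exact: leq_trans|].
by rewrite group_startS leq_addr.
Qed.

(** Every group has [N %/ M] members, and exactly the first [N %% M] groups have one more; among the
    first [k] groups, [minn k (N %% M)] are enlarged. *)
Lemma group_start_eq (N M k : nat) :
  group_start N M k = (k * (N %/ M) + minn k (N %% M))%N.
Proof.
elim: k => [|k IH]; first by rewrite group_start0 min0n.
rewrite group_startS IH /group_size mulSn.
by move: (N %% M)%N (N %/ M)%N (k * _)%N => r q a; lia.
Qed.

Lemma group_start_last (N M : nat) : (0 < M)%N -> group_start N M M = N.
Proof.
move=> M0; rewrite group_start_eq (minn_idPr (ltnW (ltn_pmod N M0))) mulnC.
by rewrite -divn_eq.
Qed.

Lemma group_disjoint (N M : nat) (i k : 'I_M) (j : 'I_N) :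
  j \in group N i -> j \in group N k -> i = k.
Proof.
have aux (a b : 'I_M) : j \in group N a -> j \in group N b -> (a <= b)%N.
  (* If [b < a], monotonicity of the starts gives [j < group_start N M b.+1 <= group_start N M a <=
     j], which is absurd. *)
  rewrite !inE => /andP[la _] /andP[_ ub]; rewrite leqNgt; apply/negP => ba.
  by have := leq_trans ub (leq_trans (leq_group_start N M _ _ ba) la); rewrite ltnn.
by move=> ji jk; apply/val_inj/eqP; rewrite eqn_leq !aux.
Qed.

Lemma group_cover (N M : nat) (j : 'I_N) :
  (0 < M)%N -> exists i : 'I_M, j \in group N i.
Proof.
move=> M0; have : (j < group_start N M M)%N by rewrite group_start_last.
have : (M <= M)%N by [].
(* Only the upper index is generalized to [k <= M]; the number of groups stays [M]. The bound [kM]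
   is what turns [k] into an index of a group. *)
elim: {1 4}M => [|k IH] kM; first by rewrite group_start0.
case: (ltnP j (group_start N M k)) => [h _|h jk]; first exact: IH (ltnW kM) h.
by exists (Ordinal kM); rewrite inE h.
Qed.

(** After exchanging the sums, each [j] is counted once: covering supplies a group containing it,
    disjointness excludes a second one. *)
Lemma sum_groups (V : nmodType) (N M : nat) (f : 'I_N -> V) : (0 < M)%N ->
  \sum_(k < M) \sum_(j in group N k) f j = \sum_j f j.
Proof.
move=> M0; rewrite (exchange_big_dep predT) //=; apply: eq_bigr => j _.
have [i ji] := group_cover N M j M0.
rewrite (big_pred1 i) // => k; apply/idP/eqP => [jk|->//].
exact: group_disjoint _ _ _ _ _ jk ji.
Qed.

Section Draws.
Variables (R : realType) (T : Type) (N M : nat).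
Variables (p : 'I_M -> R) (m : 'I_M -> T -> 'I_N).
Hypothesis m_group : forall i t, m i t \in group N i.

(** Draws with different indices lie in disjoint groups. This makes the [pick] in [rec_weight]
    unambiguous and lets sums over the committee be reindexed by groups. *)
Lemma draws_inj (t : T) : injective (fun i => m i t).
Proof.
move=> i k /= e; apply: (group_disjoint _ _ _ _ (m i t)) => //.
by rewrite e.
Qed.

Lemma rec_weight_draw (i : 'I_M) (t : T) : rec_weight p m t (m i t) = p i.
Proof.
rewrite /rec_weight; case: pickP => [k /eqP /draws_inj -> //|/(_ i)].
by rewrite eqxx.
Qed.

Lemma sum_rec_weight (t : T) :
  \sum_(k in rec_committee m t) rec_weight p m t k = \sum_i p i.
Proof.
rewrite big_imset; last by move=> i k _ _; exact: draws_inj.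
by apply: eq_bigr => i _; rewrite rec_weight_draw.
Qed.

Lemma voting_power_rec (i : 'I_M) (n : 'I_N) (t : T) :
  n \in group N i -> \sum_k p k = 1 ->
  voting_power (rec_committee m t) (rec_weight p m t) n
  = p i * \1_(m i @^-1` [set n])%classic t.
Proof.
move=> ni p1; rewrite /voting_power sum_rec_weight p1 divr1 indicE.
have [/imsetP[k _ nk]|nC] := boolP (n \in _).
  (* A committee member lying in group [i] can only be the draw from group [i]. *)
  have ik : i = k by apply: group_disjoint _ _ _ _ _ ni _; rewrite nk.
  by rewrite ik nk rec_weight_draw mem_set // mulr1.
rewrite memNset ?mulr0 //= => e.
by case/negP: nC; rewrite -e; exact: imset_f.
Qed.

End Draws.

Theorem proposition4p8 (R : realType) (N M : nat)
  (M_ge1 : (1 <= M)%N) (M_leN : (M <= N)%N)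
  (w : 'I_N -> R) (w_weight : is_weight_vector w)
  (w_sorted : forall i j : 'I_N, (i <= j)%N -> w i <= w j)
  (p : 'I_M -> R) (p_def : forall k : 'I_M, p k = \sum_(i in group N k) w i)
  (d : measure_display) (T : measurableType d) (P : probability T R)
  (m : 'I_M -> T -> 'I_N) (m_draws : rec_draws P w m) :
  fair P w (rec_committee m) (rec_weight p m).
Proof.
case: m_draws => m_meas m_group m_law n; case: w_weight => w_gt0 w_sum.
have [i ni] := group_cover N M n M_ge1.
have p_sum : \sum_k p k = 1.
  by rewrite -w_sum -(sum_groups _ N M w M_ge1); apply: eq_bigr.
(* The positive term [w n] occurs in the sum [p i]; this permits the final cancellation in
   [p i * (w n / p i)]. *)
have p_neq0 : p i != 0.
  rewrite gt_eqF // p_def (bigD1 n) //= ltr_pwDl // sumr_ge0 // => k _.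
  exact: ltW.
rewrite unlock.
under eq_integral do rewrite (voting_power_rec _ _ _ _ p m m_group i) // EFinM.
rewrite integralZl //=; last exact: integrable_indic.
rewrite integral_indic // setIT [X in (_ * X)%E](m_law i n ni) -p_def -EFinM.
by rewrite mulrC divfK.
Qed.
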